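(* Let $(A_\bullet)$ be an elliptic pre-complex based on Dirichlet conditions, with lifted complex $(\mathcal{A}_\bullet)$, and let $\mathcal{H}_D^{\alpha+1}:=\ker(\mathcal{A}_{\alpha+1},\mathcal{A}_\alpha^*,B_{\alpha+1})$. Let $\tilde{\mathcal{P}}_{\alpha-1}:\Gamma(\mathbb{E}_\alpha)\to\Gamma(\mathbb{E}_\alpha)$ be the $L^2$-orthogonal projection onto $\ker(\mathcal{A}_{\alpha-1}^* )$, so that $\mathrm{Id}-\tilde{\mathcal{P}}_{\alpha-1}$ is the projection onto $\mathrm{Im}(\mathcal{A}_{\alpha-1}|_{\ker B_{\alpha-1}})$. Then, for every $\alpha$, $$\mathcal{A}_\alpha=A_\alpha\tilde{\mathcal{P}}_{\alpha-1}\qquad\text{and}\qquad \mathcal{A}_\alpha^*=\tilde{\mathcal{P}}_{\alpha-1}A_\alpha^*,$$ and $$\mathcal{H}_D^{\alpha+1}=\ker(A_{\alpha+1},\tilde{\mathcal{P}}_{\alpha-1}A_\alpha^*,B_{\alpha+1}).$$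
   Context: Setting. $M$ is a compact Riemannian manifold with smooth boundary $\partial M$; $\mathbb{E}_\alpha\to M$ and $\mathbb{J}_\alpha\to\partial M$, $\alpha\in\mathbb{N}_0$, are Riemannian vector bundles; $\Gamma(\cdot)$ denotes smooth sections (Fréchet topology); $\langle\cdot,\cdot\rangle$ denotes $L^2$ products over $M$ or $\partial M$. One is given differential operators $A_\alpha:\Gamma(\mathbb{E}_\alpha)\to\Gamma(\mathbb{E}_{\alpha+1})$ of order $m_\alpha=\mathrm{ord}(A_\alpha)$ (orders may differ with $\alpha$), differential operators $A_\alpha^*:\Gamma(\mathbb{E}_{\alpha+1})\to\Gamma(\mathbb{E}_\alpha)$, and boundary operators $B_\alpha:\Gamma(\mathbb{E}_\alpha)\to\Gamma(\mathbb{J}_\alpha)$, $B_\alpha^*:\Gamma(\mathbb{E}_{\alpha+1})\to\Gamma(\mathbb{J}_\alpha)$ (the symbol $B_\alpha^*$ is notation, not the adjoint of $B_\alpha$) satisfying Green's formulae $$\langle A_\alpha\psi,\eta\rangle_{L^2(M)}=\langle\psi,A_\alpha^*\eta\rangle_{L^2(M)}+\langle B_\alpha\psi,B_\alpha^*\eta\rangle_{L^2(\partial M)} .$$ All objects with negative index are zero, except that $\tilde{\mathcal{P}}_{-1}=\mathrm{Id}$. A boundary operator $B$ is a normal system of trace operators if $B=\bigoplus_{j=0}^rB_j$ with each $B_j$ a differential boundary operator of order $j$ whose leading normal-derivative coefficient at the boundary is a surjective bundle morphism. A system $P_1\oplus P_2\oplus B$ with $P_i$ interior differential operators of order $m_i$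 and $B=\bigoplus_{j=0}^rB_j$ is overdetermined elliptic if its (multi-order) interior principal symbol is injective at nonzero covectors and the Lopatinskii–Shapiro condition holds in the injective sense. $(A_\bullet)$ is an elliptic pre-complex based on Dirichlet conditions if for every $\alpha$: (a) $B_\alpha$, $B_\alpha^*$ are normal systems of trace operators; (b) $\mathrm{ord}(A_{\alpha+1}A_\alpha)\le\mathrm{ord}(A_\alpha)$; (c) $A_\alpha\oplus A_{\alpha-1}^*\oplus B_\alpha$ is overdetermined elliptic and $\ker B_{\alpha-1}\subseteq\ker(B_\alpha A_{\alpha-1})$. Lifted complex. $(\mathcal{A}_\bullet)$ is the unique sequence of continuous linear maps $\mathcal{A}_\alpha:\Gamma(\mathbb{E}_\alpha)\to\Gamma(\mathbb{E}_{\alpha+1})$, $\mathcal{A}_{-1}=0$, $\mathcal{A}_0=A_0$, with $\mathcal{A}_{\alpha+1}\mathcal{A}_\alpha=0$ on $\ker B_\alpha$ and $\mathcal{A}_{\alpha+1}=A_{\alpha+1}$ on $\ker\mathcal{A}_\alpha^*$. Here $\mathcal{A}_\alpha^*$ is the formal adjoint: the continuous linear map with $\langle\mathcal{A}_\alpha\psi,\eta\rangle=\langle\psi,\mathcal{A}_\alpha^*\eta\rangle+\langle B_\alpha\psi,B_\alpha^*\eta\rangle$ for all smooth $\psi,\eta$. One has the $L^2$-orthogonal direct sum $\Gamma(\mathbb{E}_\alpha)=\mathrm{Im}(\mathcal{A}_{\alpha-1}|_{\ker B_{\alpha-1}})\oplus\ker(\mathcal{A}_{\alpha-1}^* )$,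 which defines $\tilde{\mathcal P}_{\alpha-1}$. $\ker(P,Q,\dots)$ is the intersection of kernels. *)

(* Defs.v *)
From HB Require Import structures.
From mathcomp Require Import all_boot all_order all_algebra.
From mathcomp Require complex.
From mathcomp Require Import all_classical all_reals all_analysis.
Set Implicit Arguments.
Unset Strict Implicit.
Unset Printing Implicit Defensive.
Import Order.TTheory GRing.Theory Num.Theory.
Import numFieldNormedType.Exports.
Local Open Scope classical_set_scope.
Local Open Scope ring_scope.

(* Manifolds have dimension d.+1, so that half-space coordinates are vectors
   y : 'rV[R]_d.+1; coordinate 0 is the one that is nonnegative on the manifold
   and vanishes on its boundary. *)

Section HalfSpaceCalculus.
Variables (R : realType) (d : nat).
Local Notation V := 'rV[R]_d.+1.

Definition basisv (j : 'I_d.+1) : V := delta_mx 0 j.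

Definition half_space : set V := [set y | 0 <= y 0 ord0].

Definition dpart (s : seq 'I_d.+1) (F : V -> R) : V -> R :=
  foldr (fun j G y => 'D_(basisv j) G y) F s.

Definition cinfty (F : V -> R) : Prop :=
  forall s y, {for y, continuous (dpart s F)} /\
    forall j, derivable (dpart s F) y (basisv j).

(* The derivatives are taken from the right: a point of the half-space moves
   inside the half-space along +basisv j, so this makes sense up to the boundary,
   and for a function which is smooth up to the boundary it gives the
   corresponding partial derivative of any smooth extension. *)
Definition hder (j : 'I_d.+1) (f : V -> R) : V -> R :=
  fun y => lim ((h^-1 * (f (y + h *: basisv j) - f y)) @[h --> 0^'+]).

Definition hders (s : seq 'I_d.+1) (f : V -> R) : V -> R := foldr hder f s.

Definition mindex (m : nat) := {ffun 'I_d.+1 -> 'I_m.+1}.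

Definition mlen m (b : mindex m) : nat := (\sum_(j < d.+1) b j)%N.

Definition mnormal (m : nat) : mindex m :=
  [ffun j => if j == ord0 then ord_max else ord0].

Definition hmder m (b : mindex m) (f : V -> R) : V -> R :=
  foldr (fun j g => iter (b j) (hder j) g) f (enum 'I_d.+1).

End HalfSpaceCalculus.

Fixpoint iterated_integral (R : realType) (k : nat) :
    ('rV[R]_k -> \bar R) -> \bar R :=
  match k with
  | 0 => fun F => F 0
  | k'.+1 => fun F => (\int[@lebesgue_measure R]_t
      iterated_integral (fun v : 'rV[R]_k' => F (row_mx (const_mx t : 'rV_1) v)))%E
  end.

(* f is smooth on D as read in the chart phi with domain U: near each point of
   D in U, it is the restriction of a smooth function of the coordinates on R^n *)
Definition smooth_in_chart (R : realType) (d : nat) (M : topologicalType)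
    (U : set M) (phi : M -> 'rV[R]_d.+1) (D : set M) (f : M -> R) : Prop :=
  forall x, D x -> U x -> exists O : set M, [/\ open O, O x &
    exists2 F : 'rV[R]_d.+1 -> R, cinfty F &
      forall x', O x' -> D x' -> U x' -> f x' = F (phi x')].

Record bmanifold (R : realType) (d : nat) := BManifold {
  mpoint :> ptopologicalType;
  mhausdorff : hausdorff_space mpoint;
  msecond_countable : @second_countable mpoint;
  cidx : Type;
  cdom : cidx -> set mpoint;
  cmap : cidx -> mpoint -> 'rV[R]_d.+1;
  cinv : cidx -> 'rV[R]_d.+1 -> mpoint;
  cdom_cover : forall x, exists i, cdom i x;
  cdom_open : forall i, open (cdom i);
  cmap_image : forall i, exists2 O : set 'rV[R]_d.+1, open O &
    cmap i @` cdom i = O `&` half_space (R:=R) (d:=d);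
  cmapK : forall i x, cdom i x -> cinv i (cmap i x) = x;
  cmap_continuous : forall i, {within cdom i, continuous (cmap i)};
  cinv_continuous : forall i, {within cmap i @` cdom i, continuous (cinv i)};
  ctransition : forall i j k,
    smooth_in_chart (cdom i) (cmap i) (cdom j) (fun x => cmap j x 0 k)
}.

Section Geometry.
Variables (R : realType) (d : nat) (M : bmanifold R d).

Definition bd : set M := [set x | exists2 i, cdom i x & cmap i x 0 ord0 = 0].

Definition smooth_on (D : set M) (f : M -> R) : Prop :=
  forall i : cidx M, smooth_in_chart (cdom i) (cmap i) D f.

Definition cimage (i : cidx M) : set 'rV[R]_d.+1 := cmap i @` cdom i.

Definition jacobian (i j : cidx M) (x : M) : 'M[R]_d.+1 :=
  \matrix_(k, a) hder a (fun y => cmap j (cinv i y) 0 k) (cmap i x).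

Definition borelM := g_sigma_algebraType (@open M).

Definition supported_in_chart (i : cidx M) (f : M -> R) : Prop :=
  exists2 K : set M, compact K /\ K `<=` cdom i & forall x, ~ K x -> f x = 0.

(* A Riemannian metric, given by its matrices in the charts, together with
   the Riemannian measures of the manifold and of its boundary.  The latter are
   the finite Borel measures on M determined by the usual local formulae; bvol is
   the induced measure of the boundary, viewed as a measure on M. *)
Record riemannian := Riemannian {
  gmat : cidx M -> M -> 'M[R]_d.+1;
  gmat_smooth : forall i k l, smooth_on (cdom i) (fun x => gmat i x k l);
  gmat_sym : forall i x, cdom i x -> (gmat i x)^T = gmat i x;
  gmat_pos : forall i x, cdom i x -> forall v : 'rV[R]_d.+1, v != 0 ->
    0 < (v *m gmat i x *m v^T) 0 0;
  gmat_trans : forall i j x, cdom i x -> cdom j x ->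
    gmat i x = (jacobian i j x)^T *m gmat j x *m jacobian i j x;
  vol : {finite_measure set borelM -> \bar R};
  volE : forall i (f : M -> R), continuous f -> (forall x, 0 <= f x) ->
    supported_in_chart i f ->
    (\int[vol]_x (f x)%:E)%E = iterated_integral (fun y : 'rV[R]_d.+1 =>
      (\1_(cimage i) y * (f (cinv i y) *
         Num.sqrt (\det (gmat i (cinv i y)))))%:E);
  bvol : {finite_measure set borelM -> \bar R};
  bvolE : forall i (f : M -> R), continuous f -> (forall x, 0 <= f x) ->
    supported_in_chart i f ->
    (\int[bvol]_x (f x)%:E)%E = iterated_integral (fun v : 'rV[R]_d =>
      let y : 'rV[R]_(1 + d) := row_mx 0 v in
      (\1_(cimage i) y * (f (cinv i y) *
         Num.sqrt (\det (@drsubmx _ 1 d 1 d (gmat i (cinv i y))))))%:E)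
}.

(* A Riemannian vector bundle over the subset S of M (below S is M itself or
   its boundary), given by its fibres and by smooth local frames.  The fibres over
   points outside S are irrelevant. *)
Record bundle (S : set M) := Bundle {
  fib : M -> vectType R;
  fidx : Type;
  fdom : fidx -> set M;
  frk : fidx -> nat;
  frame : forall (p : fidx) (x : M), (frk p).-tuple (fib x);
  fdom_open : forall p, exists2 O : set M, open O & fdom p = O `&` S;
  fdom_cover : forall x, S x -> exists p, fdom p x;
  frame_basis : forall p x, fdom p x -> basis_of fullv (frame p x);
  frame_trans : forall p q k l, smooth_on (fdom p `&` fdom q)
    (fun x => coord (frame q x) k (tnth (frame p x) l));
  bmetric : forall x, fib x -> fib x -> R;
  bmetric_linear : forall x, S x -> forall a (u v w : fib x),
    bmetric (a *: u + v) w = a * bmetric u w + bmetric v w;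
  bmetric_sym : forall x, S x -> forall u v : fib x,
    bmetric u v = bmetric v u;
  bmetric_pos : forall x, S x -> forall u : fib x, u != 0 -> 0 < bmetric u u;
  bmetric_smooth : forall p k l, smooth_on (fdom p)
    (fun x => bmetric (tnth (frame p x) k) (tnth (frame p x) l))
}.

Definition scoef (S : set M) (E : bundle S) (p : fidx E) (k : 'I_(frk p))
    (u : forall x, fib E x) : M -> R :=
  fun x => coord (frame p x) k (u x).

Definition smooth_section (S : set M) (E : bundle S)
    (u : forall x, fib E x) : Prop :=
  (forall (p : fidx E) (k : 'I_(frk p)), smooth_on (fdom p) (scoef k u)) /\
  (forall x, ~ S x -> u x = 0).

(* Smooth sections over S; the value outside S is fixed to be 0, so that
   equality of sections is equality over S. *)
Record gamma (S : set M) (E : bundle S) := Gamma {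
  sval_of :> forall x, fib E x;
  smooth_of : smooth_section sval_of
}.

End Geometry.

Section SmoothSections.
Variables (R : realType) (d : nat).

Lemma dpart_lin (a : R) (s : seq 'I_d.+1) (F G : 'rV[R]_d.+1 -> R) :
  cinfty F -> cinfty G ->
  dpart s (fun y => a * F y + G y) = (fun y => a * dpart s F y + dpart s G y).
Proof.
move=> cF cG; elim: s => [|j s IH] //=.
rewrite IH; apply/funext => y.
have derF := (cF s y).2 j; have derG := (cG s y).2 j.
rewrite (_ : (fun y => a * dpart s F y + dpart s G y) =
             (a \*: dpart s F) + dpart s G)//.
by rewrite deriveD ?deriveZ//; exact: derivableZ.
Qed.

Lemma cinfty_lin (a : R) (F G : 'rV[R]_d.+1 -> R) :
  cinfty F -> cinfty G -> cinfty (fun y => a * F y + G y).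
Proof.
move=> cF cG s y; rewrite dpart_lin//; split.
  apply: continuousD; last exact: (cG s y).1.
  by apply: continuousM; [exact: cst_continuous|exact: (cF s y).1].
move=> j; apply: (@derivableD _ _ _ (a \*: dpart s F) (dpart s G)).
  exact: derivableZ ((cF s y).2 j).
exact: (cG s y).2.
Qed.

Lemma cinfty0 : cinfty (fun _ : 'rV[R]_d.+1 => 0).
Proof.
have dpart0 (s : seq 'I_d.+1) :
    dpart s (fun _ : 'rV[R]_d.+1 => 0 : R) = (fun _ => 0).
  elim: s => [|j s IH] //=; rewrite IH; apply/funext => y.
  exact: (@derive_cst _ _ _ (0 : R)).
move=> s y; rewrite dpart0; split; first exact: cst_continuous.
by move=> j; exact: derivable_cst.
Qed.

Variable M : bmanifold R d.

Lemma smooth_on0 (D : set M) : smooth_on D (fun _ => 0).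
Proof.
move=> i x Dx ix; exists setT; split => //; first exact: openT.
by exists (fun _ => 0) => //; exact: cinfty0.
Qed.

Lemma smooth_on_lin (a : R) (D : set M) (f g : M -> R) :
  smooth_on D f -> smooth_on D g -> smooth_on D (fun x => a * f x + g x).
Proof.
move=> sf sg i x Dx ix.
have [ O [oO Ox [F cF fF]]] := sf i x Dx ix.
have [ O' [oO' O'x [G cG gG]]] := sg i x Dx ix.
exists (O `&` O'); split => //; first exact: openI.
exists (fun y => a * F y + G y); first exact: cinfty_lin.
by move=> x' [Ox' O'x'] Dx' ix'; rewrite fF// gG.
Qed.

Variables (S : set M) (E : bundle S).

Lemma smooth_section0 : smooth_section (fun x => 0 : fib E x).
Proof.
split=> // p k; rewrite (_ : scoef k _ = (fun _ => 0)); first exact: smooth_on0.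
by apply/funext => x; rewrite /scoef linear0.
Qed.

Lemma smooth_section_lin (a : R) (u v : gamma E) :
  smooth_section (fun x => a *: u x + v x : fib E x).
Proof.
split=> [p k|x nSx]; last first.
  by rewrite (smooth_of u).2// (smooth_of v).2// scaler0 addr0.
rewrite (_ : scoef k _ = fun x => a * scoef k u x + scoef k v x).
  exact: smooth_on_lin ((smooth_of u).1 p k) ((smooth_of v).1 p k).
by apply/funext => x; rewrite /scoef linearP.
Qed.

Lemma gamma_eq (u v : gamma E) : (forall x, u x = v x) -> u = v.
Proof.
case: u v => [u su] [v sv] /= uv.
have {}uv : u = v by exact: functional_extensionality_dep.
by case: _ / uv sv => sv; congr Gamma; exact: Prop_irrelevance.
Qed.

HB.instance Definition _ := gen_eqMixin (gamma E).
HB.instance Definition _ := gen_choiceMixin (gamma E).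

Definition gamma0 : gamma E := Gamma smooth_section0.
Definition gamma_lin (a : R) (u v : gamma E) : gamma E :=
  Gamma (smooth_section_lin a u v).
Definition gamma_add (u v : gamma E) := gamma_lin 1 u v.
Definition gamma_opp (u : gamma E) := gamma_lin (-1) u gamma0.
Definition gamma_scale (a : R) (u : gamma E) := gamma_lin a u gamma0.

Lemma gamma_addA : associative gamma_add.
Proof. by move=> u v w; apply: gamma_eq => x /=; rewrite !scale1r addrA. Qed.

Lemma gamma_addC : commutative gamma_add.
Proof. by move=> u v; apply: gamma_eq => x /=; rewrite !scale1r addrC. Qed.

Lemma gamma_add0 : left_id gamma0 gamma_add.
Proof. by move=> u; apply: gamma_eq => x /=; rewrite scale1r add0r. Qed.

Lemma gamma_addN : left_inverse gamma0 gamma_opp gamma_add.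
Proof.
by move=> u; apply: gamma_eq => x /=; rewrite scale1r addr0 scaleN1r addNr.
Qed.

HB.instance Definition _ := GRing.isZmodule.Build (gamma E)
  gamma_addA gamma_addC gamma_add0 gamma_addN.

Lemma gamma_scaleA a b (u : gamma E) :
  gamma_scale a (gamma_scale b u) = gamma_scale (a * b) u.
Proof. by apply: gamma_eq => x /=; rewrite !addr0 scalerA. Qed.

Lemma gamma_scale1 : left_id 1 gamma_scale.
Proof. by move=> u; apply: gamma_eq => x /=; rewrite addr0 scale1r. Qed.

Lemma gamma_scaleDr : right_distributive gamma_scale +%R.
Proof.
by move=> a u v; apply: gamma_eq => x /=; rewrite !addr0 !scale1r scalerDr.
Qed.

Lemma gamma_scaleDl (u : gamma E) :
  {morph gamma_scale^~ u : a b / a + b >-> a + b}.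
Proof.
by move=> a b; apply: gamma_eq => x /=; rewrite !addr0 !scale1r scalerDl.
Qed.

HB.instance Definition _ := GRing.Zmodule_isLmodule.Build R (gamma E)
  gamma_scaleA gamma_scale1 gamma_scaleDr gamma_scaleDl.

End SmoothSections.

Section ZeroBundle.
Variables (R : realType) (d : nat) (M : bmanifold R d) (S : set M).
Local Notation Z := ('rV[R]_0).

Let zfib (x : M) : vectType R := Z.

Let zframe (p : unit) (x : M) : 0.-tuple (zfib x) := [tuple].

Let zopen (p : unit) : exists2 O : set M, open O & S = O `&` S.
Proof. by exists setT; [exact: openT|rewrite setTI]. Qed.

Let zcover (x : M) : S x -> exists p : unit, S x.
Proof. by exists tt. Qed.

Let zbasis (p : unit) (x : M) : S x -> basis_of fullv (zframe p x).
Proof.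
move=> _; rewrite basisEfree nil_free subvf size_tuple /= dimvf.
by rewrite /dim /= muln0.
Qed.

Let zeq0 (u : Z) : u = 0.
Proof. by apply/rowP => -[]. Qed.

Let ztrans (p q : unit) (k l : 'I_0) : smooth_on (S `&` S)
  (fun x => coord (zframe q x) k (tnth (zframe p x) l)).
Proof. by case: k. Qed.

Definition zero_bundle : bundle S.
Proof.
refine (@Bundle R d M S zfib unit (fun=> S) (fun=> 0%N) zframe zopen zcover
  zbasis ztrans (fun _ _ _ => 0) _ _ _ _).
- by move=> *; rewrite mulr0 addr0.
- by [].
- by move=> x _ u; rewrite (zeq0 u) eqxx.
- by move=> p [].
Defined.

End ZeroBundle.

Section Operators.
Variables (R : realType) (d : nat) (M : bmanifold R d).

Definition L2 (mu : {finite_measure set (borelM M) -> \bar R}) (S : set M)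
    (E : bundle S) (u v : gamma E) : R :=
  (\int[mu]_(x in S) bmetric (u x) (v x))%R.

(* The seminorms sup_K |d^s u_k| (in a chart and a frame) defining the Frechet
   topology of the space of smooth sections over M. *)
Record seminorm_index (E : bundle [set: M]) := SeminormIndex {
  sn_chart : cidx M;
  sn_frame : fidx E;
  sn_comp : 'I_(frk sn_frame);
  sn_set : set M;
  sn_compact : compact sn_set;
  sn_sub : sn_set `<=` cdom sn_chart `&` fdom sn_frame;
  sn_der : seq 'I_d.+1
}.

Definition seminorm (E : bundle [set: M]) (t : seminorm_index E)
    (u : gamma E) : R :=
  sup [set `|hders (sn_der t) (fun y => scoef (sn_comp t) u (cinv (sn_chart t) y))
               (cmap (sn_chart t) x)| | x in sn_set t].

Definition frechet_continuous (E F : bundle [set: M])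
    (P : gamma E -> gamma F) : Prop :=
  forall (u : gamma E) (t : seminorm_index F) (e : R), 0 < e ->
  exists (N : nat) (s : 'I_N -> seminorm_index E) (r : R), 0 < r /\
    forall v : gamma E, (forall n, seminorm (s n) (v - u) < r) ->
      seminorm t (P v - P u) < e.

Section LocalForm.
Variables (S : set M) (E : bundle [set: M]) (F : bundle S).

(* Operators are considered here with values in arbitrary families of vectors,
   so that they can be composed with fibrewise projections. *)
Implicit Type P : gamma E -> forall x, fib F x.

Definition ldom (i : cidx M) (p : fidx E) (q : fidx F) : set M :=
  S `&` cdom i `&` fdom p `&` fdom q.

(* P u = sum_(|b| <= m) a_b d^b u in the chart i and the frames p, q.  The
   coefficients a_b with |b| <= m are determined by P on ldom i p q. *)
Definition local_form (m : nat) P (i : cidx M) (p : fidx E) (q : fidx F)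
    (a : mindex d m -> M -> 'M[R]_(frk q, frk p)) : Prop :=
  (forall b k l, smooth_on (ldom i p q) (fun x => a b x k l)) /\
  forall (u : gamma E) x, ldom i p q x -> forall k,
    scoef k (P u) x = \sum_(b | (mlen b <= m)%N) \sum_l
      a b x k l * hmder b (fun y => scoef l u (cinv i y)) (cmap i x).

Definition order_le (m : nat) P : Prop :=
  forall i p q, exists a, local_form (m := m) P i (p := p) (q := q) a.

Definition has_order (m : nat) P : Prop :=
  order_le m P /\ forall k, order_le k P -> (m <= k)%N.

(* principal symbol at the covector xi, up to the factor i^m *)
Definition symbol (m r r' : nat) (a : mindex d m -> 'M[R]_(r', r))
    (xi : 'rV[R]_d.+1) : 'M[R]_(r', r) :=
  \sum_(b | mlen b == m) (\prod_j xi 0 j ^+ b j) *: a b.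

End LocalForm.

Definition op (S S' : set M) (E : bundle S) (F : bundle S')
  (P : gamma E -> gamma F) : gamma E -> forall x, fib F x := fun u => P u.

(* J = J_0 (+) ... (+) J_r, given by the projections onto the summands *)
Record splitting (J : bundle (@bd R d M)) := Splitting {
  srank : nat;
  spart : 'I_srank.+1 -> bundle (@bd R d M);
  sproj : forall (j : 'I_srank.+1) x, {linear fib J x -> fib (spart j) x};
  sproj_smooth : forall j (p : fidx J) (q : fidx (spart j)) k l,
    smooth_on (fdom p `&` fdom q)
      (fun x => coord (frame q x) k (sproj j x (tnth (frame p x) l)));
  sproj_inj : forall x, bd x -> forall v : fib J x,
    (forall j, sproj j x v = 0) -> v = 0;
  sproj_surj : forall x, bd x -> forall w : (forall j, fib (spart j) x),
    exists v : fib J x, forall j, sproj j x v = w j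
}.

Section Boundary.
Variables (E : bundle [set: M]) (J : bundle (@bd R d M)).

Definition trace_part (s : splitting J) (B : gamma E -> gamma J)
    (j : 'I_(srank s).+1) : gamma E -> forall x, fib (spart j) x :=
  fun u x => sproj j x (B u x).

(* The coefficient of the j-th power of the derivative in the 0-th coordinate
   is, up to a nonzero scalar, that of the j-th normal derivative. *)
Definition normal_system (s : splitting J) (B : gamma E -> gamma J) : Prop :=
  forall j : 'I_(srank s).+1,
    order_le j (trace_part B j) /\
    forall i (p : fidx E) (q : fidx (spart j)) a,
      local_form (m := j) (trace_part B j) i (p := p) (q := q) a ->
      forall x, ldom i p q x -> forall w : 'cV[R]_(frk q),
        exists v : 'cV[R]_(frk p), a (mnormal d j) x *m v = w.

End Boundary.

Section Lopatinskii.
Import complex.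
Local Open Scope complex_scope.

Definition csmooth (w : R -> R[i]) : Prop :=
  forall n t, derivable (derive1n n (fun s => Re (w s))) t 1 /\
              derivable (derive1n n (fun s => Im (w s))) t 1.

Definition cder (n : nat) (w : R -> R[i]) : R -> R[i] := fun t =>
  derive1n n (fun s => Re (w s)) t +i* derive1n n (fun s => Im (w s)) t.

Definition decaying (w : R -> R[i]) : Prop :=
  (fun t => Re (w t)) @ +oo --> (0 : R) /\ (fun t => Im (w t)) @ +oo --> (0 : R).

(* principal symbol on the half-line: d_j is replaced by i xi_j for the
   tangential coordinates j > 0, and d_0 by d/dt *)
Definition halfline_symbol (m r r' : nat) (a : mindex d m -> 'M[R]_(r', r))
    (xi : 'rV[R]_d) (w : 'I_r -> R -> R[i]) (k : 'I_r') (t : R) : R[i] :=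
  \sum_(b | mlen b == m) \sum_l
    (a b k l)%:C * (\prod_(j < d) (Complex 0 (xi 0 j)) ^+ b (lift ord0 j)) *
    cder (b ord0) (w l) t.

Definition interior_elliptic (E F1 F2 : bundle [set: M])
    (m1 : nat) (P1 : gamma E -> gamma F1)
    (m2 : nat) (P2 : gamma E -> gamma F2) : Prop :=
  forall i (p : fidx E) (q1 : fidx F1) (q2 : fidx F2) a1 a2,
    local_form (m := m1) (op P1) i (p := p) (q := q1) a1 ->
    local_form (m := m2) (op P2) i (p := p) (q := q2) a2 ->
    forall x, ldom i p q1 x -> ldom i p q2 x ->
    forall xi : 'rV[R]_d.+1, xi != 0 -> forall v : 'cV[R]_(frk p),
      symbol (a1^~ x) xi *m v = 0 -> symbol (a2^~ x) xi *m v = 0 -> v = 0.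

Definition lopatinskii_shapiro (E F1 F2 : bundle [set: M])
    (J : bundle (@bd R d M)) (m1 : nat) (P1 : gamma E -> gamma F1)
    (m2 : nat) (P2 : gamma E -> gamma F2)
    (s : splitting J) (B : gamma E -> gamma J) : Prop :=
  forall i (p : fidx E) (q1 : fidx F1) (q2 : fidx F2)
    (q : forall j : 'I_(srank s).+1, fidx (spart j)) a1 a2
    (c : forall j : 'I_(srank s).+1, mindex d j -> M -> 'M[R]_(frk (q j), frk p)),
    local_form (m := m1) (op P1) i (p := p) (q := q1) a1 ->
    local_form (m := m2) (op P2) i (p := p) (q := q2) a2 ->
    (forall j : 'I_(srank s).+1, local_form (m := j) (trace_part B j) i (p := p)
      (q := q j) (c j)) ->
    forall x, bd x ->
    ldom i p q1 x -> ldom i p q2 x -> (forall j, ldom i p (q j) x) ->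
    forall xi : 'rV[R]_d, xi != 0 -> forall w : 'I_(frk p) -> R -> R[i],
      (forall l, csmooth (w l)) -> (forall l, decaying (w l)) ->
      (forall k t, 0 <= t -> halfline_symbol (a1^~ x) xi w k t = 0) ->
      (forall k t, 0 <= t -> halfline_symbol (a2^~ x) xi w k t = 0) ->
      (forall j k, halfline_symbol (fun b => c j b x) xi w k 0 = 0) ->
      forall l t, 0 <= t -> w l t = 0.

End Lopatinskii.

Definition overdetermined_elliptic (E F1 F2 : bundle [set: M])
    (J : bundle (@bd R d M)) (m1 : nat) (P1 : gamma E -> gamma F1)
    (m2 : nat) (P2 : gamma E -> gamma F2)
    (s : splitting J) (B : gamma E -> gamma J) : Prop :=
  [/\ has_order m1 (op P1), has_order m2 (op P2),
      forall j : 'I_(srank s).+1, order_le j (trace_part B j),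
      interior_elliptic m1 P1 m2 P2 &
      lopatinskii_shapiro m1 P1 m2 P2 s B].

(* Objects with index alpha - 1; those with negative index are zero.  In
   particular the kernel of pre_bwd cAs 0 is everything, and the orthogonal
   projection onto it is the identity. *)
Definition preb (S : set M) (E : nat -> bundle S) (al : nat) : bundle S :=
  if al is be.+1 then E be else zero_bundle S.

Definition pre_op (S : set M) (E : nat -> bundle [set: M]) (F : nat -> bundle S)
    (A : forall al, {linear gamma (E al) -> gamma (F al)}) (al : nat) :
    {linear gamma (preb E al) -> gamma (preb F al)} :=
  match al with be.+1 => A be | 0 => \0 end.

Definition pre_fwd (E : nat -> bundle [set: M])
    (A : forall al, {linear gamma (E al) -> gamma (E al.+1)}) (al : nat) :
    {linear gamma (preb E al) -> gamma (E al)} :=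
  match al with be.+1 => A be | 0 => \0 end.

Definition pre_bwd (E : nat -> bundle [set: M])
    (A : forall al, {linear gamma (E al.+1) -> gamma (E al)}) (al : nat) :
    {linear gamma (E al) -> gamma (preb E al)} :=
  match al with be.+1 => A be | 0 => \0 end.

Definition pre_ord (m : nat -> nat) (al : nat) : nat :=
  if al is be.+1 then m be else 0%N.

Section Complexes.
Variable g : riemannian M.
Variables (E : nat -> bundle [set: M]) (J : nat -> bundle (@bd R d M)).
Implicit Types
  (A : forall al, {linear gamma (E al) -> gamma (E al.+1)})
  (As : forall al, {linear gamma (E al.+1) -> gamma (E al)})
  (B : forall al, {linear gamma (E al) -> gamma (J al)})
  (Bs : forall al, {linear gamma (E al.+1) -> gamma (J al)}).

Definition green A As B Bs : Prop :=
  forall al (psi : gamma (E al)) (eta : gamma (E al.+1)),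
    L2 (vol g) (A al psi) eta =
    L2 (vol g) psi (As al eta) + L2 (bvol g) (B al psi) (Bs al eta).

Definition elliptic_precomplex A As B Bs (m ms : nat -> nat) : Prop :=
  forall al, exists s ss : splitting (J al),
    [/\ normal_system s (B al) /\ normal_system ss (Bs al),
        order_le (m al) (op (A al.+1 \o A al)),
        overdetermined_elliptic (m al) (A al)
          (pre_ord ms al) (pre_bwd As al) s (B al) &
        forall u, pre_op B al u = 0 -> B al (pre_fwd A al u) = 0].

Definition lifted_complex A B Bs
    (cA : forall al, {linear gamma (E al) -> gamma (E al.+1)})
    (cAs : forall al, {linear gamma (E al.+1) -> gamma (E al)}) : Prop :=
  [/\ (forall al, frechet_continuous (cA al)) /\
      (forall al, frechet_continuous (cAs al)),
      green cA cAs B Bs,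
      forall u, cA 0%N u = A 0%N u,
      forall al u, B al u = 0 -> cA al.+1 (cA al u) = 0 &
      forall al u, cAs al u = 0 -> cA al.+1 u = A al.+1 u].

(* Gamma(E_alpha) = Im(cA_(alpha-1) on ker B_(alpha-1)) (+) ker cAs_(alpha-1),
   orthogonally in L^2 *)
Definition orthogonal_decomposition B
    (cA : forall al, {linear gamma (E al) -> gamma (E al.+1)})
    (cAs : forall al, {linear gamma (E al.+1) -> gamma (E al)}) : Prop :=
  forall al,
    (forall u : gamma (E al), exists phi v,
      [/\ pre_op B al phi = 0, pre_bwd cAs al v = 0 &
          u = pre_fwd cA al phi + v]) /\
    (forall phi v, pre_op B al phi = 0 -> pre_bwd cAs al v = 0 ->
      L2 (vol g) (pre_fwd cA al phi) v = 0).

Definition orthogonal_projection (F : bundle [set: M])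
    (K : set (gamma F)) (P : gamma F -> gamma F) : Prop :=
  forall u, K (P u) /\ forall v, K v -> L2 (vol g) (u - P u) v = 0.

Definition dirichlet_harmonic B
    (cA : forall al, {linear gamma (E al) -> gamma (E al.+1)})
    (cAs : forall al, {linear gamma (E al.+1) -> gamma (E al)})
    (al : nat) : set (gamma (E al.+1)) :=
  [set u | [/\ cA al.+1 u = 0, cAs al u = 0 & B al.+1 u = 0]].

End Complexes.
End Operators.

Arguments dirichlet_harmonic {R d M E J} B cA cAs al.

(* Main.v *)
Require Import Defs.
From mathcomp Require Import all_boot all_order all_algebra.
From mathcomp Require Import all_classical all_reals all_analysis.
From mathcomp Require Import lra.
Set Implicit Arguments.
Unset Strict Implicit.
Unset Printing Implicit Defensive.
Import Order.TTheory GRing.Theory Num.Theory.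
Import numFieldNormedType.Exports.
Local Open Scope classical_set_scope.
Local Open Scope ring_scope.

(** Write K for the kernel of the adjoint cAs_(alpha-1).  Each section of
E_alpha splits as psi = cA_(alpha-1) phi + v with B phi = 0 and v in K, and v is
P psi, because the orthogonal projection of psi on K is unique.  The operator
cA_alpha kills the first summand and agrees with A_alpha on the second one, so
cA_alpha psi = A_alpha (P psi): this is [lifted_fwd].

For the adjoints, the two Green formulae have the same boundary term.  They give
<v, As eta> = <v, cAs eta> for v in K, where A_alpha v = cA_alpha v.  So the
difference As eta - cAs eta is orthogonal to K, and cAs eta = P (As eta) as soon
as cAs eta lies in K ([lifted_bwd]).  This last point is that the adjoints form
a complex too ([lifted_adjoint_complex0]).  Let cA phi + v be the splitting of
cAs eta.  Then <cA phi, cA phi> = <cA phi, cAs eta> = <cA cA phi, eta> minus a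
boundary term in B (cA phi).  Both terms vanish; the second one because the
lifted operators inherit from A_alpha the inclusion of ker B_(alpha-1) in
ker (B_alpha A_(alpha-1)) ([lifted_boundary], by induction on alpha).  The
description of the harmonic fields follows from the two formulae.

These arguments use that the L^2 product is bilinear and definite on smooth
sections.  Bilinearity holds since fibre products of smooth sections are
continuous, hence integrable on a compact manifold ([L2Bl]).  Definiteness
([L2_eq0]) means that the Riemannian measure charges nonempty open sets
([vol_integral_gt0]).  A bump function reduces this to the local formula for
the measure in a chart, whose density is positive since a positive definite
matrix has a positive determinant ([posdef_det_gt0]); the iterated integral of
a function bounded below by a positive constant on a box is then positive
([iterated_integral_box]). *)

(** * Determinants of positive definite matrices *)

Lemma dotmul_gt0 (R : realDomainType) n (v : 'rV[R]_n) :
  v != 0 -> 0 < (v *m v^T) 0 0.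
Proof.
move=> v0; have [j vj] : exists j, v 0 j != 0.
  by apply/existsP; apply: contraNT v0 => /existsPn v0; apply/eqP/rowP => j;
     rewrite mxE; apply/eqP; rewrite -[_ == _]negbK.
rewrite mxE (bigD1 j)//= mxE ltr_wpDr ?sumr_ge0// => [i _|].
  by rewrite mxE -expr2 sqr_ge0.
by rewrite -expr2 lt_def sqr_ge0 andbT sqrf_eq0.
Qed.

(** On the segment from A to the identity matrix all matrices are positive
definite, hence invertible: the determinant, which is polynomial along the
segment and equal to 1 at its end, cannot change sign. *)
Lemma posdef_det_gt0 (R : rcfType) n (A : 'M[R]_n) :
  (forall v : 'rV[R]_n, v != 0 -> 0 < (v *m A *m v^T) 0 0) -> 0 < \det A.
Proof.
move=> Apos; rewrite ltNge; apply/negP => A_le0.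
pose p : {poly R} :=
  \det (map_mx polyC A + 'X *: map_mx polyC (1%:M - A)).
have pE t : p.[t] = \det (A + t *: (1%:M - A)).
  rewrite /p -horner_evalE -det_map_mx; congr (\det _).
  by apply/matrixP => i j; rewrite !mxE /= horner_evalE !hornerE.
have [||t /andP[t0 t1]] := @poly_ivt R p 0 1.
- exact: ler01.
- by rewrite !pE scale0r addr0 scale1r addrC subrK det1 A_le0 ler01.
rewrite rootE pE => /det0P[v v0].
move/(congr1 (fun w : 'rV[R]_n => (w *m v^T) 0 0)).
rewrite mul0mx mulmxDr -scalemxAr mulmxBr mulmx1 mulmxDl -scalemxAl mulmxBl.
have a0 := Apos v v0; have b0 := dotmul_gt0 v0.
rewrite mxE [X in _ + X]mxE [X in _ * X]mxE [X in _ * (_ + X)]mxE [RHS]mxE.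
by move: ((v *m A *m v^T) 0 0) ((v *m v^T) 0 0) a0 b0 => a b a0 b0 e; nra.
Qed.

(** * Monotonicity and iterated integrals *)

(** The integral of a nonnegative function is a supremum over the simple
functions below it, so it is monotone in arbitrary functions.  This generality
serves the iterated integrals, whose inner integrals may fail to be measurable
in the outer variable. *)
Lemma ge0_integral_mono dd (T : measurableType dd) (R : realType)
    (mu : {measure set T -> \bar R}) (f1 f2 : T -> \bar R) :
  (forall x, 0 <= f1 x)%E -> (forall x, f1 x <= f2 x)%E ->
  (\int[mu]_x f1 x <= \int[mu]_x f2 x)%E.
Proof.
move=> f10 f12; have f20 x : (0 <= f2 x)%E by exact: le_trans (f12 x).
rewrite !ge0_integralTE//; apply: le_ereal_sup => _ [h hf1 <-].
by exists h => // x; exact: le_trans (f12 x).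
Qed.

Lemma iterated_integral_ge0 (R : realType) k (F : 'rV[R]_k -> \bar R) :
  (forall v, 0 <= F v)%E -> (0 <= iterated_integral F)%E.
Proof.
elim: k F => [|k IH] F F0 /=; first exact: F0.
by apply: integral_ge0 => t _; apply: IH.
Qed.

(** Each integration over a side of the box multiplies the lower bound by the
length of that side; elsewhere the integrand is nonnegative. *)
Lemma iterated_integral_box (R : realType) k (a : 'rV[R]_k) (e c : R)
    (F : 'rV[R]_k -> \bar R) : 0 < e -> 0 < c -> (forall v, 0 <= F v)%E ->
  (forall v : 'rV[R]_k, (forall j, a 0 j <= v 0 j <= a 0 j + e) ->
     (c%:E <= F v)%E) ->
  ((e ^+ k * c)%:E <= iterated_integral F)%E.
Proof.
move=> e0 c0; elim: k a F => [|k IH] a F F0 Fc /=.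
  by rewrite mul1r; apply: Fc => -[].
pose I := `[a 0 ord0, a 0 ord0 + e]%classic.
have lb t : (((fun=> (e ^+ k * c)%:E) \_ I) t <=
    iterated_integral (fun v : 'rV_k => F (row_mx (const_mx t : 'rV_1) v)))%E.
  rewrite patchE; case: ifPn => [|_]; last exact: iterated_integral_ge0.
  rewrite inE /I /= in_itv /= => tI.
  apply: (IH (\row_j a 0 (lift ord0 j))) => // v hv; apply: Fc => j.
  have [i ->|->] := unliftP ord0 j.
    suff -> : row_mx (const_mx t : 'rV_1) v 0 (lift ord0 i) = v 0 i.
      by have := hv i; rewrite mxE.
    by rewrite -(row_mxEr (const_mx t : 'rV_1) v); congr (row_mx _ _ _ _);
      apply: val_inj.
  suff -> : row_mx (const_mx t : 'rV_1) v 0 ord0 = t by [].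
  transitivity ((const_mx t : 'rV[R]_1) 0 0); last by rewrite mxE.
  by rewrite -[RHS](row_mxEl _ v); congr (row_mx _ _ _ _); apply: val_inj.
apply: le_trans (ge0_integral_mono lebesgue_measure _ lb).
  rewrite -integral_mkcond integral_cst; last exact: measurable_itv.
  rewrite [X in (_ * X)%E]lebesgue_measure_itv /= lte_fin.
  by rewrite ltrDl e0 -EFinB -EFinM lee_fin addrAC subrr add0r exprS; lra.
move=> t; rewrite /patch; case: ifP => // _.
by rewrite lee_fin mulr_ge0 ?exprn_ge0// ltW.
Qed.

(** * Continuity of the determinant *)

Lemma continuous_at_sum (K : numFieldType) (T : topologicalType) (I : Type)
    (r : seq I) (P : pred I) (f : I -> T -> K) (x : T) :
  (forall i, {for x, continuous (f i)}) ->
  {for x, continuous (fun y => \sum_(i <- r | P i) f i y)}.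
Proof.
move=> cf; apply: (@cvg_big K I +%R 0 P) => [|i _]; last exact: cf.
exact: (@add_continuous K).
Qed.

Lemma continuous_at_prod (K : numFieldType) (T : topologicalType) (I : Type)
    (r : seq I) (P : pred I) (f : I -> T -> K) (x : T) :
  (forall i, {for x, continuous (f i)}) ->
  {for x, continuous (fun y => \prod_(i <- r | P i) f i y)}.
Proof.
move=> cf; apply: (@cvg_big K I *%R 1 P) => [|i _]; last exact: cf.
exact: mul_continuous.
Qed.

Lemma det_continuous (R : realType) (T : topologicalType) n
    (A : T -> 'M[R]_n) (x : T) :
  (forall i j, {for x, continuous (fun y => A y i j)}) ->
  {for x, continuous (fun y => \det (A y))}.
Proof.
move=> cA; rewrite /determinant /=.
apply: continuous_at_sum => s; apply: cvgM; first exact: cvg_cst.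
by apply: continuous_at_prod => i; exact: cA.
Qed.

(** * Continuous functions and smooth sections on a manifold *)

Section Continuity.
Variables (R : realType) (d : nat) (M : bmanifold R d).

Lemma continuous_borel_measurable (f : M -> R) :
  continuous f -> measurable_fun [set: borelM M] f.
Proof.
move=> /continuousP cf.
apply: (measurability _ (measurable_realfun.RGenOpens.measurableE R)).
move=> _ [_ [a [b ->]] <-]; rewrite setTI.
by apply: sub_sigma_algebra; apply: cf; exact: interval_open.
Qed.

Lemma continuous_integrable (mu : {finite_measure set (borelM M) -> \bar R})
    (f : M -> R) :
  compact [set: M] -> continuous f -> mu.-integrable setT (EFin \o f).
Proof.
move=> hM cf; apply: measurable_bounded_integrable => //.
- exact: fin_num_fun_lty (fin_num_measure mu).
- exact: continuous_borel_measurable.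
have /compact_bounded[m [mR bm]] :=
  continuous_compact (continuous_subspaceT cf) hM.
by exists m; split=> // m' mm' x _; apply: bm mm' _ _; exists x.
Qed.

Lemma smooth_on_continuous (D : set M) (f : M -> R) x :
  open D -> D x -> smooth_on D f -> {for x, continuous f}.
Proof.
move=> oD Dx sf; have [i ix] := cdom_cover x.
have [ O [oO Ox [F cF fF]]] := sf i x Dx ix.
have nO : nbhs x (O `&` (D `&` cdom i)).
  apply: open_nbhs_nbhs; split=> //; apply: openI => //; apply: openI => //.
  exact: cdom_open.
have cm : {for x, continuous (cmap i)}.
  have := @cmap_continuous _ _ M i.
  rewrite continuous_open_subspace; last exact: cdom_open.
  by apply; rewrite inE.
rewrite /prop_for /continuous_at fF//.
apply: (@cvg_trans _ (F \o cmap i @ x)).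
  apply: near_eq_cvg; apply: filterS nO => y [Oy [Dy iy]].
  by rewrite /= fF.
by apply: continuous_comp => //; exact: (cF [::] (cmap i x)).1.
Qed.

Lemma bmetric0l S (E : @bundle R d M S) x (w : fib E x) :
  S x -> bmetric 0 w = 0.
Proof.
move=> Sx; have := bmetric_linear Sx 1 0 0 w.
by rewrite scale1r addr0 mul1r -[LHS]addr0 => /addrI.
Qed.

Section Bundle.
Variable E : bundle [set: M].

Lemma fdom_openT (p : fidx E) : open (fdom p).
Proof. by have [ O oO ->] := fdom_open p; rewrite setIT. Qed.

Lemma bmetric_suml x I (r : seq I) (a : I -> R) (u : I -> fib E x) w :
  bmetric (\sum_(i <- r) a i *: u i) w = \sum_(i <- r) a i * bmetric (u i) w.
Proof.
elim: r => [|i r IH]; first by rewrite !big_nil bmetric0l.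
by rewrite !big_cons bmetric_linear// IH.
Qed.

Lemma bmetric_frame (p : fidx E) x (u v : fib E x) : fdom p x ->
  bmetric u v = \sum_k coord (frame p x) k u * (\sum_l coord (frame p x) l v *
     bmetric (tnth (frame p x) k) (tnth (frame p x) l)).
Proof.
move=> px; rewrite {1}(coord_basis (frame_basis px) (memvf u)) bmetric_suml.
apply: eq_bigr => k _; congr (_ * _); rewrite bmetric_sym//.
rewrite {1}(coord_basis (frame_basis px) (memvf v)) bmetric_suml.
by apply: eq_bigr => l _; rewrite -!tnth_nth bmetric_sym.
Qed.

(** In a smooth local frame the product is a polynomial in the components of
the two sections and in the entries of the Gram matrix of the frame. *)
Lemma bmetric_continuous (u v : gamma E) :
  continuous (fun x => bmetric (u x) (v x)).
Proof.
move=> x; have [p px] := @fdom_cover _ _ _ _ E x I.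
pose G y := \sum_k scoef k u y * (\sum_l scoef l v y *
     bmetric (tnth (frame p y) k) (tnth (frame p y) l)).
have GE y : fdom p y -> bmetric (u y) (v y) = G y by exact: bmetric_frame.
have c f : smooth_on (fdom p) f -> {for x, continuous f}.
  by apply: smooth_on_continuous => //; exact: fdom_openT.
rewrite /prop_for /continuous_at GE//; apply: (@cvg_trans _ (G @ x)).
  apply: near_eq_cvg; have : nbhs x (fdom p).
    by apply: open_nbhs_nbhs; split => //; exact: fdom_openT.
  by apply: filterS => y /GE.
apply: continuous_at_sum => k.
apply: cvgM; first by apply/c/(smooth_of u).1.
apply: continuous_at_sum => l.
apply: cvgM; first by apply/c/(smooth_of v).1.
exact/c/bmetric_smooth.
Qed.

End Bundle.

End Continuity.

(** * The L2 product of smooth sections *)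

Section L2Product.
Variables (R : realType) (d : nat) (M : bmanifold R d) (g : riemannian M).
Hypothesis hM : compact [set: M].

(** A function supported in a chart is integrated there against the density
sqrt (det g), so its integral is bounded below by that of a constant over a
small box.  The box has the image of x as its lowest corner: it then stays in
the half-space even if x is a boundary point. *)
Lemma supported_in_chart_gt0 (i : cidx M) (h : M -> R) x :
  continuous h -> (forall y, 0 <= h y) -> supported_in_chart i h ->
  cdom i x -> 0 < h x -> (0 < \int[vol g]_y (h y)%:E)%E.
Proof.
move=> ch h0 hs ix hx; rewrite (volE g ch h0 hs).
set F := (X in iterated_integral X).
pose G y := h y * Num.sqrt (\det (gmat g i y)).
have G0 y : 0 <= G y by rewrite mulr_ge0 ?sqrtr_ge0.
have Gx : 0 < G x.
  by rewrite mulr_gt0// sqrtr_gt0 posdef_det_gt0//; exact: gmat_pos.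
have cG : {for x, continuous G}.
  apply: cvgM; first exact: ch.
  apply: (@continuous_comp _ _ _ (fun y => \det (gmat g i y)) Num.sqrt).
    apply: det_continuous => k l.
    by apply: smooth_on_continuous (cdom_open i) ix _; exact: gmat_smooth.
  exact: sqrt_continuous.
have nG : nbhs x [set y | G x / 2 < G y].
  apply: (cG [set r | G x / 2 < r]); apply: open_nbhs_nbhs.
  by split; [exact: open_gt|rewrite /=; lra].
have [ O oO imO] := cmap_image i.
have Ox : cimage i (cmap i x) by exists x.
have nbox : nbhs (cmap i x)
    [set y | half_space y -> cimage i y /\ G x / 2 < G (cinv i y)].
  have /subspace_continuousP/(_ _ Ox) := @cinv_continuous _ _ M i.
  rewrite /from_subspace cmapK// => /(_ _ nG) /= nbi.
  have nO : nbhs (cmap i x) O.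
    by apply: open_nbhs_nbhs; split => //; move: Ox; rewrite /cimage imO => -[].
  apply: filterS2 nO nbi => y /= Oy Gy hy.
  have iy : cimage i y by rewrite /cimage imO.
  by split => //; exact: Gy.
move/nbhs_ballP : nbox => [e /= e0 be].
have e20 : 0 < e / 2 by rewrite divr_gt0.
have c0 : 0 < G x / 2 by rewrite divr_gt0.
apply: (@lt_le_trans _ _ ((e / 2) ^+ d.+1 * (G x / 2))%:E).
  by rewrite lte_fin mulr_gt0// exprn_gt0.
apply: (@iterated_integral_box R d.+1 (cmap i x) _ _ F) => // [y|y hy].
  by rewrite /F lee_fin mulr_ge0//; exact: G0.
have [||iy Gy] := be y.
- split => // k l; rewrite (ord1 k) /ball /= ltr_distlC.
  by have := hy l; lra.
- rewrite /half_space /=; have /andP[+ _] := hy ord0; apply: le_trans.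
  by move: Ox; rewrite /cimage imO => -[].
by rewrite /F lee_fin indicE mem_set// mul1r; exact: ltW.
Qed.

(** A Urysohn function equal to 1 at x and vanishing outside a neighbourhood
of x whose closure lies in a chart cuts f down to a smaller function that is
supported in this chart. *)
Lemma vol_integral_gt0 (f : M -> R) x :
  continuous f -> (forall y, 0 <= f y) -> 0 < f x ->
  (0 < \int[vol g]_y (f y)%:E)%E.
Proof.
move=> cf f0 fx; have [i ix] := cdom_cover x.
have haus : hausdorff_space M by exact: mhausdorff.
have nix : nbhs x (cdom i).
  by apply: open_nbhs_nbhs; split => //; exact: cdom_open.
have [V nV Vi] : filter_from (nbhs x) closure (cdom i).
  by apply: (compact_regular haus hM) nix; exact: filterT.
have cW : closed (~` V^°) by apply/open_closedC/open_interior.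
have cx : closed [set x] by apply/accessible_closed_set1/hausdorff_accessible.
have := normal_uniform_separator (compact_normal haus hM) cW cx.
have -> : ~` V^° `&` [set x] = set0.
  by rewrite -subset0 => y [+ /= yx]; rewrite yx; apply.
move=> /(_ erefl)/(@uniform_separatorP _ R)[chi [cchi chi01 chi0 chi1]].
have chix : chi x = 1 by apply: chi1; exists x.
have chiI y : 0 <= chi y <= 1.
  by have := chi01 (chi y); rewrite /= in_itv; apply; exists y.
pose h y := chi y * f y.
have h0 y : 0 <= h y by rewrite mulr_ge0//; case/andP : (chiI y).
have ch : continuous h by move=> y; apply: cvgM; [exact: cchi|exact: cf].
apply: (@lt_le_trans _ _ (\int[vol g]_y (h y)%:E)%E).
  apply: (@supported_in_chart_gt0 i h x) => //; last by rewrite /h chix mul1r.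
  exists (closure V) => [|y nVy].
    split => //; apply: subclosed_compact hM _ => //; exact: closed_closure.
  rewrite /h (_ : chi y = 0) ?mul0r//.
  apply: chi0; exists y => // Vy; apply: nVy.
  by apply: subset_closure; exact: interior_subset Vy.
apply: ge0_integral_mono => y; rewrite lee_fin//.
by rewrite ler_piMl//; case/andP : (chiI y).
Qed.

Section L2.
Variable E : bundle [set: M].
Implicit Types u v w : gamma E.

Lemma L2C u v : L2 (vol g) u v = L2 (vol g) v u.
Proof. by apply: eq_Rintegral => x _; rewrite bmetric_sym. Qed.

Lemma L2Bl u v w : L2 (vol g) (u - v) w = L2 (vol g) u w - L2 (vol g) v w.
Proof.
rewrite /L2 -RintegralB//; try exact/continuous_integrable/bmetric_continuous.
apply: eq_Rintegral => x _.
have -> : (u - v) x = (-1) *: v x + u x by rewrite /= scale1r addr0 addrC.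
by rewrite bmetric_linear// mulN1r addrC.
Qed.

(** The squared length of u is a nonnegative continuous function; if it were
positive somewhere, its integral would be positive. *)
Lemma L2_eq0 u : L2 (vol g) u u = 0 -> u = 0.
Proof.
move=> u0; apply: gamma_eq => x; apply/eqP; apply/negPn/negP => ux.
have pos y : 0 <= bmetric (u y) (u y).
  have [->|uy] := eqVneq (u y) 0; first by rewrite bmetric0l.
  by rewrite ltW// bmetric_pos.
have cu : continuous (fun y => bmetric (u y) (u y)).
  exact: bmetric_continuous.
have : (0 < \int[vol g]_y (bmetric (u y) (u y))%:E)%E.
  by apply: (@vol_integral_gt0 _ x) => //; exact: bmetric_pos.
have /integrable_fin_num := continuous_integrable (vol g) hM cu.
move=> /(_ measurableT) /fineK <-.
by rewrite lte_fin -[fine _]/(L2 (vol g) u u) u0 ltxx.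
Qed.

End L2.

End L2Product.

Lemma L2_0l (R : realType) (d : nat) (M : bmanifold R d) mu S
    (E : @bundle R d M S) (v : gamma E) : L2 mu 0 v = 0.
Proof. by rewrite /L2 /Rintegral integral0_eq// => x /bmetric0l ->. Qed.

(** * The lifted complex *)

(** The difference P u - w lies in K and is orthogonal to K, so it is zero since
the L2 product is definite. *)
Lemma orthogonal_projection_unique (R : realType) (d : nat) (M : bmanifold R d)
    (g : riemannian M) (hM : compact [set: M]) (F : bundle [set: M])
    (K : set (gamma F)) (P : gamma F -> gamma F) :
  (forall u v, K u -> K v -> K (u - v)) ->
  orthogonal_projection g K P -> forall u w, K w ->
  (forall v, K v -> L2 (vol g) (u - w) v = 0) -> P u = w.
Proof.
move=> KB hP u w Kw uw; have [KP uP] := hP u.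
apply/subr0_eq/(L2_eq0 (g := g) hM).
have KPw := KB _ _ KP Kw.
have e : P u - w = (u - w) - (u - P u) by rewrite opprB [RHS]addrC addrA subrK.
by rewrite {1}e L2Bl// uw// uP// subr0.
Qed.

Section Lifted.
Variables (R : realType) (d : nat) (M : bmanifold R d).
Hypothesis hM : compact [set: M].
Variable g : riemannian M.
Variables (E : nat -> bundle [set: M]) (J : nat -> bundle (@bd R d M)).
Variables
  (A : forall al, {linear gamma (E al) -> gamma (E al.+1)})
  (As : forall al, {linear gamma (E al.+1) -> gamma (E al)})
  (B : forall al, {linear gamma (E al) -> gamma (J al)})
  (Bs : forall al, {linear gamma (E al.+1) -> gamma (J al)}).
Variables
  (cA : forall al, {linear gamma (E al) -> gamma (E al.+1)})
  (cAs : forall al, {linear gamma (E al.+1) -> gamma (E al)}).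
Hypothesis hgreen : green g A As B Bs.
Hypothesis hker : forall al u,
  pre_op B al u = 0 -> B al (pre_fwd A al u) = 0.
Hypothesis hlift : lifted_complex g A B Bs cA cAs.
Hypothesis hdec : orthogonal_decomposition g B cA cAs.

Lemma lifted_eq al v : pre_bwd cAs al v = 0 -> cA al v = A al v.
Proof. by case: hlift => _ _ h0 _ h; case: al v => [v _|al v /h]. Qed.

Lemma lifted_complex0 al u :
  pre_op B al u = 0 -> cA al (pre_fwd cA al u) = 0.
Proof.
by case: hlift => _ _ _ h _; case: al u => [u _|al u /h//]; rewrite linear0.
Qed.

(** Let v be the component of u in the kernel of the adjoint.  By induction B
vanishes on the other component, so B v = 0; as cA u = A v, the hypothesis that
A maps ker B to ker B applies to v. *)
Lemma lifted_boundary al u :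
  pre_op B al u = 0 -> B al (pre_fwd cA al u) = 0.
Proof.
elim: al u => [u _|al IH u Bu /=]; first by rewrite linear0.
have [phi [v [Bphi Kv uE]]] := (hdec al).1 u.
have Bv : B al v = 0.
  by move: Bu; rewrite /= uE linearD IH// add0r.
have -> : cA al u = A al v.
  by rewrite uE linearD lifted_complex0// add0r lifted_eq.
exact: (hker (al := al.+1)) Bv.
Qed.

(** The component of cAs eta in the image of cA on ker B is orthogonal to itself:
this is Green's formula for cA phi and eta, where both cA (cA phi) and the
boundary value B (cA phi) vanish. *)
Lemma lifted_adjoint_complex0 al eta : pre_bwd cAs al (cAs al eta) = 0.
Proof.
have [phi [v [Bphi Kv cE]]] := (hdec al).1 (cAs al eta).
have [_ gr _ _ _] := hlift.
suff : pre_fwd cA al phi = 0 by move=> e; rewrite cE e add0r.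
apply: (L2_eq0 (g := g) hM).
have e : pre_fwd cA al phi = cAs al eta - v by rewrite cE addrK.
have := gr al (pre_fwd cA al phi) eta.
rewrite lifted_complex0// lifted_boundary// !L2_0l addr0 => ort.
by rewrite {1}e L2Bl// L2C -ort L2C ((hdec al).2 phi v) // subr0.
Qed.

Variable P : forall al, gamma (E al) -> gamma (E al).
Arguments P : clear implicits.
Hypothesis hP : forall al,
  orthogonal_projection g [set u | pre_bwd cAs al u = 0] (P al).

Let proj_eq al u w : pre_bwd cAs al w = 0 ->
  (forall v, pre_bwd cAs al v = 0 -> L2 (vol g) (u - w) v = 0) -> P al u = w.
Proof.
move=> Kw uw; apply: (orthogonal_projection_unique hM _ (@hP al)) => // a b /=.
by move=> Ka Kb; rewrite linearB Ka Kb subr0.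
Qed.

Lemma lifted_fwd al psi : cA al psi = A al (P al psi).
Proof.
have [phi [v [Bphi Kv ->]]] := (hdec al).1 psi.
rewrite linearD lifted_complex0// add0r (proj_eq (w := v)) ?lifted_eq//.
by move=> k Kk; rewrite addrK; exact: (hdec al).2.
Qed.

(** As A v = cA v for v in the kernel K of the previous adjoint, and the two
Green formulae have the same boundary term, As eta - cAs eta is orthogonal
to K. *)
Lemma lifted_bwd al eta : cAs al eta = P al (As al eta).
Proof.
apply/esym/proj_eq => [|v Kv]; first exact: lifted_adjoint_complex0.
have [_ gr _ _ _] := hlift.
have := hgreen v eta; rewrite -lifted_eq// gr => /addIr e.
by rewrite L2Bl// L2C -e L2C subrr.
Qed.

End Lifted.

Theorem theorem2p6 (R : realType) (d : nat) (M : bmanifold R d)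
  (hM : compact [set: M]) (g : riemannian M)
  (E : nat -> bundle [set: M]) (J : nat -> bundle (@bd R d M))
  (A : forall al, {linear gamma (E al) -> gamma (E al.+1)})
  (As : forall al, {linear gamma (E al.+1) -> gamma (E al)})
  (B : forall al, {linear gamma (E al) -> gamma (J al)})
  (Bs : forall al, {linear gamma (E al.+1) -> gamma (J al)})
  (m ms : nat -> nat)
  (hm : forall al, has_order (m al) (op (A al)))
  (hms : forall al, has_order (ms al) (op (As al)))
  (hgreen : green g A As B Bs)
  (hell : elliptic_precomplex A As B Bs m ms)
  (cA : forall al, {linear gamma (E al) -> gamma (E al.+1)})
  (cAs : forall al, {linear gamma (E al.+1) -> gamma (E al)})
  (hlift : lifted_complex g A B Bs cA cAs)
  (hdec : orthogonal_decomposition g B cA cAs)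
  (P : forall al, gamma (E al) -> gamma (E al))
  (hP : forall al,
    orthogonal_projection g [set u | pre_bwd cAs al u = 0] (P al)) :
  forall al : nat,
    [/\ forall psi : gamma (E al), cA al psi = A al (P al psi),
        forall eta : gamma (E al.+1), cAs al eta = P al (As al eta) &
        dirichlet_harmonic B cA cAs al =
          [set u : gamma (E al.+1) |
            [/\ A al.+1 u = 0, P al (As al u) = 0 & B al.+1 u = 0]]].
Proof.
have hker al u : pre_op B al u = 0 -> B al (pre_fwd A al u) = 0.
  by have [s [ss [_ _ _]]] := hell al; apply.
have fwd := lifted_fwd hM hlift hdec hP.
have bwd := lifted_bwd hM hgreen hker hlift hdec hP.
move=> al; split; [exact: fwd|exact: bwd|].
apply/seteqP; split => u [/= Au Asu Bu].
  by rewrite -bwd -(lifted_eq hlift (al := al.+1)).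
have cAsu : cAs al u = 0 by rewrite bwd.
by split=> //; rewrite (lifted_eq hlift (al := al.+1)).
Qed.
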